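(* $n(4,11) \leq 713$; that is, there exists a $4$-regular graph of girth exactly $11$ with at most $713$ vertices.
   Context: Graphs are finite and simple. For integers $k\ge 2$, $g\ge 3$, a $(k,g)$-graph is a $k$-regular graph with girth $g$ (the length of a shortest cycle is exactly $g$). $n(k,g)$ denotes the smallest possible number of vertices of a $(k,g)$-graph. *)

(* Defs.v *)
From mathcomp Require Import all_boot.

Set Implicit Arguments.
Unset Strict Implicit.
Unset Printing Implicit Defensive.

(* Finite simple graphs: symmetric irreflexive adjacency on a finite type. *)
Record sgraph := SGraph {
  vertex :> finType;
  adj : rel vertex;
  adj_sym : symmetric adj;
  adj_irr : irreflexive adj
}.

Definition regular (k : nat) (G : sgraph) : Prop :=
  forall x : G, #|[set y : G | adj x y]| = k.

(* [ucycle] alone also accepts the empty sequence and a single edge walked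
   back and forth, whence the bound on the size.  The length of the cycle is
   [size c], as the edge from the last vertex back to the first is implicit. *)
Definition is_cycle (G : sgraph) (c : seq G) : Prop :=
  ucycle (@adj G) c /\ 3 <= size c.

(* A relation rather than a function, since an acyclic graph has no (finite)
   girth. *)
Definition has_girth (G : sgraph) (g : nat) : Prop :=
  (exists2 c : seq G, is_cycle c & size c = g)
  /\ forall c : seq G, is_cycle c -> g <= size c.

Definition kg_graph (k g : nat) (G : sgraph) : Prop :=
  regular k G /\ has_girth G g.

(* [min_order k g n] says that n(k,g) is defined and equal to n; a relation
   avoids a default value for when no (k,g)-graph exists. *)
Definition min_order (k g n : nat) : Prop :=
  (exists2 G : sgraph, kg_graph k g G & #|G| = n)
  /\ forall G : sgraph, kg_graph k g G -> n <= #|G|.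

(* Main.v *)
Require Import Defs.
From mathcomp Require Import all_boot.
From mathcomp Require Import zify.
From Stdlib Require Import Wf_nat Classical_Prop.
From Stdlib Require Import NArith FMapPositive.

(** Delete a vertex [w] from the incidence graph of the split Cayley hexagon
    H(3), which is 4-regular of girth 12 on 728 vertices, and join neighbours
    of [w] with one another.  A new edge shortens by one the cycles that passed
    through [w] between its two ends; on any other cycle, the passage through
    [w] keeps its length or disappears.  So a cycle of length less than 11 can
    only come from a cycle with at least two shortened passages, and one can
    delete 15 vertices in such a way that there are none: they are taken among
    the 22 vertices on the four geodesics between two opposite points.  A kept
    vertex which has lost two neighbours may receive both its new edges inside
    the neighbourhood of the same deleted vertex.

    Girth at least 11 is checked by computation, in the form that the
    nonbacktracking walks of length at most 5 from any given vertex have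
    distinct ends. *)

Set Implicit Arguments.
Unset Strict Implicit.
Unset Printing Implicit Defensive.

(** * Short cycles and nonbacktracking walks *)

(** Used with [g y] the ends of the walks whose first step goes to [y]: when no end is repeated, the
    end of a walk determines its first step. *)
Lemma uniq_flatten_map_inj (S T : eqType) (g : S -> seq T) (s : seq S) a b z :
  uniq (flatten [seq g y | y <- s]) -> a \in s -> b \in s ->
  z \in g a -> z \in g b -> a = b.
Proof.
elim: s => //= y s IHs; rewrite cat_uniq => /and3P[_ /hasPn dis us].
have notin c : c \in s -> z \in g c -> z \notin g y.
  by move=> cs zc; apply: dis; apply/flatten_mapP; exists c.
rewrite !inE => /predU1P[-> | sa] /predU1P[-> | sb] // za zb.
- by have := notin _ sb zb; rewrite za.
- by have := notin _ sa za; rewrite zb.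
- exact: IHs us sa sb za zb.
Qed.

Definition nbrel (T : eqType) (nb : T -> seq T) : rel T :=
  fun x y => y \in nb x.

(** There is one entry per nonbacktracking walk of length at most [d] from [x], so that [uniq] says
    that distinct walks have distinct ends. The vertex [p] is the one just left, to which the next
    step may not return. Starting with [p = x] excludes only a loop at [x]. *)
Fixpoint walk_ends (T : eqType) (nb : T -> seq T) (d : nat) (p x : T) : seq T :=
  x :: (if d is d'.+1 then
          flatten [seq walk_ends nb d' x y | y <- [seq y <- nb x | y != p]]
        else [::]).

(** A walk without repeated vertices never turns back. Having [p] among the distinct vertices covers
    the first step as well. *)
Lemma last_walk_ends (T : eqType) (nb : T -> seq T) d p x q :
  path (nbrel nb) x q -> uniq (p :: x :: q) -> size q <= d ->
  last x q \in walk_ends nb d p x.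
Proof.
elim: q d p x => [|y q IHq] [|d] p x //=; rewrite ?mem_head //.
case/andP=> exy qpath /and3P[pxyq xyq yq] szq.
rewrite inE; apply/orP; right; apply/flatten_mapP; exists y.
  rewrite mem_filter [_ \in nb x]exy andbT.
  by apply: contraNneq pxyq => ->; rewrite !inE eqxx orbT.
by apply: IHq => //=; rewrite xyq.
Qed.

(* The two halves of a short cycle, read from a common vertex, are walks with
   the same end but different first steps. *)
Lemma short_cycleF (T : eqType) (nb : T -> seq T) d c :
  {in c &, symmetric (nbrel nb)} ->
  {in c, forall x, uniq (walk_ends nb d x x)} ->
  ucycle (nbrel nb) c -> 3 <= size c <= d.*2 -> False.
Proof.
move=> e_sym all_uniq /andP[cyc_c uniq_c] /andP[c_ge3 c_le].
case: c => [|x t] // in e_sym all_uniq cyc_c uniq_c c_ge3 c_le *.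
case: d => [|d] // in all_uniq c_le *.
have := all_uniq x (mem_head _ _); rewrite /= => /andP[_ u].
(* The cycle is cut as [x, y, t1, w, t2]. From [x], one walk goes through [y] and [t1] to [w], the
   other through [t2] backwards to [w]. After the case analysis on [d], the new [d] is the length
   still allowed once the first step is made. *)
move: cyc_c uniq_c c_ge3 c_le; rewrite /= -[t](cat_take_drop (size t)./2).
have : size (take (size t)./2 t) = (size t)./2 by rewrite size_takel //; lia.
have : {subset drop (size t)./2 t <= t} by move=> z; apply: mem_drop.
have := size_drop (size t)./2 t.
case: (take _ t) => [|y t1] /=; first by lia.
case: (drop _ t) => [|w t2] /=; first by lia.
rewrite rcons_cat /= cat_path /= size_cat /= => szt2 sub_t szt1.
case/and4P=> exy yt1 t1w wt2 /andP[xt /andP[yt ut]] t_ge2 t_le.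
have [t1_le t2_le] : size t1 < d /\ size t2 <= d.
  by move: szt1 szt2 t_le; clear; lia.
have revp : path (nbrel nb) x (rev (w :: t2)).
  have := rev_path (nbrel nb) w (rcons t2 x).
  rewrite belast_rcons last_rcons => ->.
  (* Reversal produces the converse relation, which agrees with [nbrel nb] on the vertices of the
     cycle, where symmetry is assumed. *)
  rewrite (@eq_in_path _ [in x :: t] _ (nbrel nb)) //.
    by move=> a b a_in b_in; apply: e_sym.
  apply/allP=> z; rewrite -rcons_cons mem_rcons !inE => /predU1P[-> | /sub_t ->].
    by rewrite eqxx.
  by rewrite orbT.
have lastr : last x (rev (w :: t2)) = w by rewrite rev_cons last_rcons.
have ur : uniq (x :: rev (w :: t2)).
  rewrite cons_uniq rev_uniq mem_rev; move: xt ut.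
  by rewrite inE mem_cat !negb_or cat_uniq => /and3P[_ _ ->] /and3P[].
have szr : size (rev (w :: t2)) = (size t2).+1 by rewrite size_rev.
have memr b : b \in rev (w :: t2) -> b \in w :: t2 by rewrite mem_rev.
case: (rev _) revp lastr ur szr memr => [|b q] //= /andP[exb bq] lastr uxbq [szq] memr.
have bwt2 : b \in w :: t2 by apply: memr; rewrite mem_head.
have xb : b != x by apply: contraTneq uxbq => ->; rewrite mem_head.
have yx : y != x by apply: contraNneq xt => ->; rewrite mem_head.
(* The vertex [b] is the first step of the reversed half. As both walks end at [w], their first
   steps must agree. *)
have yb : y = b.
  apply: (uniq_flatten_map_inj (z := w) u).
  - by rewrite mem_filter yx.
  - by rewrite mem_filter xb.
  - have := @last_walk_ends _ nb d x y (rcons t1 w).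
    rewrite last_rcons; apply.
    + by rewrite rcons_path yt1.
    + move: xt yt ut; rewrite -cat_rcons !cons_uniq cat_uniq !inE !mem_cat.
      by rewrite !negb_or => /and3P[-> -> _] /andP[-> _] /andP[-> _].
    + by rewrite size_rcons.
  - by rewrite -lastr; apply: last_walk_ends => //; rewrite szq.
(* But [b] lies on the second half of a cycle without repetition, and [y] on the first. *)
by move: yt; rewrite yb mem_cat bwt2 orbT.
Qed.

(** * Fast test for repetitions *)

(** A search tree replaces the quadratic [uniq]: in a 4-regular graph, each starting vertex has 1 +
    4 + 12 + 36 + 108 + 324 = 485 walks of length at most 5. Keys are positive while 0 is a label,
    hence the shift by [N.succ_pos]. *)
Fixpoint distinct (seen : PositiveMap.t unit) (s : seq N) : bool :=
  if s is x :: s' then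
    if PositiveMap.find (N.succ_pos x) seen is Some _ then false
    else distinct (PositiveMap.add (N.succ_pos x) tt seen) s'
  else true.

Lemma succ_pos_inj : injective N.succ_pos.
Proof. by move=> x y /(congr1 Pos.pred_N); rewrite !N.pos_pred_succ. Qed.

(** The second conclusion is what carries the induction: the head has been added to the tree by the
    time the tail is read, so it cannot occur in the tail. *)
Lemma distinct_uniq seen s :
  distinct seen s ->
  uniq s /\ forall x, x \in s -> PositiveMap.find (N.succ_pos x) seen = None.
Proof.
elim: s seen => //= x s IHs seen.
case Ex: (PositiveMap.find _ seen) => [//|] /IHs[us sN]; split.
  rewrite us andbT; apply/negP=> /sN.
  by rewrite PositiveMap.gss.
move=> y; rewrite inE => /predU1P[-> //|ys].
have := sN y ys; rewrite PositiveMap.gso // => /succ_pos_inj yx.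
by have := sN y ys; rewrite yx PositiveMap.gss.
Qed.

(* The vertices are 0, ..., 712, and row [i] lists the neighbours of [i]. *)
Definition rows : seq (seq N) := [::
  [:: 361; 362; 363; 364]; [:: 365; 366; 367; 368]; [:: 371; 372; 373; 374];
  [:: 375; 376; 377; 378]; [:: 382; 383; 384; 385]; [:: 386; 387; 388; 389];
  [:: 393; 394; 395; 396]; [:: 397; 398; 399; 400]; [:: 9; 401; 402; 403];
  [:: 8; 404; 405; 406]; [:: 13; 407; 408; 409]; [:: 15; 410; 411; 412];
  [:: 14; 413; 414; 415]; [:: 10; 416; 417; 418]; [:: 12; 419; 420; 421];
  [:: 11; 422; 423; 424]; [:: 425; 426; 427; 428]; [:: 429; 430; 431; 432];
  [:: 433; 434; 435; 436]; [:: 437; 438; 439; 440]; [:: 441; 442; 443; 444];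
  [:: 445; 446; 447; 448]; [:: 449; 450; 451; 452]; [:: 453; 454; 455; 456];
  [:: 457; 458; 459; 460]; [:: 461; 462; 463; 464]; [:: 465; 466; 467; 468];
  [:: 469; 470; 471; 472]; [:: 473; 474; 475; 476]; [:: 477; 478; 479; 480];
  [:: 481; 482; 483; 484]; [:: 485; 486; 487; 488]; [:: 489; 490; 491; 492];
  [:: 493; 494; 495; 496]; [:: 354; 497; 498; 499]; [:: 354; 500; 501; 502];
  [:: 39; 461; 473; 485]; [:: 371; 503; 504; 505]; [:: 375; 506; 507; 508];
  [:: 36; 425; 437; 449]; [:: 375; 509; 510; 511]; [:: 371; 512; 513; 514];
  [:: 407; 515; 516; 517]; [:: 441; 518; 519; 520]; [:: 481; 521; 522; 523];
  [:: 408; 524; 525; 526]; [:: 453; 527; 528; 529]; [:: 469; 530; 531; 532];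
  [:: 409; 533; 534; 535]; [:: 429; 536; 537; 538]; [:: 493; 539; 540; 541];
  [:: 416; 542; 543; 544]; [:: 489; 545; 546; 547]; [:: 457; 548; 549; 550];
  [:: 417; 551; 552; 553]; [:: 465; 554; 555; 556]; [:: 445; 557; 558; 559];
  [:: 418; 560; 561; 562]; [:: 477; 563; 564; 565]; [:: 433; 566; 567; 568];
  [:: 365; 369; 386; 393]; [:: 365; 569; 570; 571]; [:: 365; 572; 573; 574];
  [:: 369; 469; 481; 493]; [:: 386; 575; 576; 577]; [:: 393; 578; 579; 580];
  [:: 369; 433; 445; 457]; [:: 393; 581; 582; 583]; [:: 386; 584; 585; 586];
  [:: 437; 587; 588; 589]; [:: 409; 590; 591; 592]; [:: 477; 593; 594; 595];
  [:: 449; 596; 597; 598]; [:: 407; 599; 600; 601]; [:: 465; 602; 603; 604];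
  [:: 425; 605; 606; 607]; [:: 408; 608; 609; 610]; [:: 489; 611; 612; 613];
  [:: 485; 614; 615; 616]; [:: 417; 617; 618; 619]; [:: 453; 620; 621; 622];
  [:: 461; 623; 624; 625]; [:: 418; 626; 627; 628]; [:: 441; 629; 630; 631];
  [:: 473; 632; 633; 634]; [:: 416; 635; 636; 637]; [:: 429; 638; 639; 640];
  [:: 361; 370; 382; 397]; [:: 361; 641; 642; 643]; [:: 361; 644; 645; 646];
  [:: 370; 465; 477; 489]; [:: 382; 647; 648; 649]; [:: 397; 650; 651; 652];
  [:: 370; 429; 441; 453]; [:: 397; 653; 654; 655]; [:: 382; 656; 657; 658];
  [:: 473; 659; 660; 661]; [:: 408; 662; 663; 664]; [:: 445; 665; 666; 667];
  [:: 461; 668; 669; 670]; [:: 409; 671; 672; 673]; [:: 457; 674; 675; 676];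
  [:: 485; 677; 678; 679]; [:: 407; 680; 681; 682]; [:: 433; 683; 684; 685];
  [:: 449; 686; 687; 688]; [:: 418; 689; 690; 691]; [:: 493; 692; 693; 694];
  [:: 437; 695; 696; 697]; [:: 416; 698; 699; 700]; [:: 469; 701; 702; 703];
  [:: 425; 704; 705; 706]; [:: 417; 707; 708; 709]; [:: 481; 710; 711; 712];
  [:: 355; 542; 545; 548]; [:: 355; 515; 518; 521]; [:: 358; 426; 430; 434];
  [:: 362; 686; 689; 692]; [:: 366; 587; 590; 593]; [:: 358; 462; 466; 470];
  [:: 366; 614; 617; 620]; [:: 362; 659; 662; 665]; [:: 404; 497; 572; 641];
  [:: 446; 498; 602; 707]; [:: 494; 499; 638; 671]; [:: 405; 527; 596; 674];
  [:: 438; 530; 635; 642]; [:: 490; 524; 573; 704]; [:: 406; 563; 632; 710];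
  [:: 442; 560; 574; 668]; [:: 486; 566; 599; 643]; [:: 401; 500; 569; 644];
  [:: 478; 501; 626; 683]; [:: 454; 502; 608; 701]; [:: 402; 557; 629; 695];
  [:: 482; 551; 605; 645]; [:: 450; 554; 570; 680]; [:: 403; 539; 611; 677];
  [:: 474; 536; 571; 698]; [:: 458; 533; 623; 646]; [:: 359; 376; 387; 398];
  [:: 359; 450; 454; 458]; [:: 359; 486; 490; 494]; [:: 376; 516; 531; 537];
  [:: 387; 591; 603; 606]; [:: 398; 663; 669; 684]; [:: 376; 543; 558; 564];
  [:: 398; 690; 696; 711]; [:: 387; 618; 630; 633]; [:: 434; 509; 612; 708];
  [:: 426; 540; 636; 653]; [:: 430; 561; 584; 678]; [:: 405; 510; 585; 654];
  [:: 406; 519; 588; 666]; [:: 404; 555; 624; 702]; [:: 482; 511; 621; 672];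
  [:: 478; 525; 586; 687]; [:: 474; 549; 600; 655]; [:: 466; 506; 627; 675];
  [:: 470; 552; 597; 650]; [:: 462; 528; 575; 699]; [:: 403; 507; 576; 651];
  [:: 401; 567; 639; 705]; [:: 402; 522; 594; 660]; [:: 442; 508; 609; 693];
  [:: 438; 546; 577; 681]; [:: 446; 534; 615; 652]; [:: 360; 372; 383; 394];
  [:: 360; 438; 442; 446]; [:: 360; 474; 478; 482]; [:: 372; 544; 556; 568];
  [:: 383; 691; 703; 706]; [:: 394; 619; 625; 640]; [:: 372; 517; 529; 541];
  [:: 394; 592; 598; 613]; [:: 383; 664; 676; 679]; [:: 470; 503; 631; 673];
  [:: 466; 526; 578; 697]; [:: 462; 559; 601; 647]; [:: 406; 504; 579; 648];
  [:: 404; 538; 607; 685]; [:: 405; 547; 616; 694]; [:: 458; 505; 595; 709];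
  [:: 450; 523; 637; 649]; [:: 454; 562; 580; 661]; [:: 430; 512; 610; 712];
  [:: 426; 565; 581; 682]; [:: 434; 535; 634; 656]; [:: 402; 513; 582; 657];
  [:: 403; 550; 622; 688]; [:: 401; 532; 604; 670]; [:: 490; 514; 628; 667];
  [:: 494; 553; 589; 658]; [:: 486; 520; 583; 700]; [:: 356; 560; 563; 566];
  [:: 356; 533; 536; 539]; [:: 390; 463; 483; 491]; [:: 395; 616; 631; 637];
  [:: 399; 660; 675; 681]; [:: 390; 427; 447; 455]; [:: 399; 687; 702; 708];
  [:: 395; 589; 604; 610]; [:: 413; 518; 598; 684]; [:: 439; 521; 628; 654];
  [:: 479; 515; 580; 705]; [:: 414; 499; 578; 655]; [:: 459; 497; 613; 699];
  [:: 471; 498; 622; 663]; [:: 415; 554; 634; 693]; [:: 431; 551; 579; 669];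
  [:: 487; 557; 592; 653]; [:: 419; 548; 640; 696]; [:: 495; 542; 607; 652];
  [:: 451; 545; 582; 672]; [:: 420; 501; 583; 650]; [:: 467; 502; 619; 666];
  [:: 443; 500; 601; 711]; [:: 421; 530; 595; 678]; [:: 475; 527; 581; 690];
  [:: 435; 524; 625; 651]; [:: 367; 377; 384; 391]; [:: 367; 605; 608; 611];
  [:: 367; 632; 635; 638]; [:: 377; 522; 528; 534]; [:: 384; 694; 697; 709];
  [:: 391; 471; 479; 487]; [:: 377; 549; 555; 561]; [:: 391; 435; 443; 451];
  [:: 384; 667; 670; 682]; [:: 447; 510; 593; 700]; [:: 415; 537; 587; 676];
  [:: 475; 567; 590; 649]; [:: 413; 511; 573; 647]; [:: 467; 516; 574; 688];
  [:: 455; 552; 572; 679]; [:: 495; 509; 629; 664]; [:: 427; 531; 626; 648];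
  [:: 414; 546; 623; 712]; [:: 491; 508; 617; 685]; [:: 420; 558; 620; 706];
  [:: 459; 525; 614; 657]; [:: 421; 506; 571; 658]; [:: 439; 564; 569; 673];
  [:: 463; 519; 570; 691]; [:: 431; 507; 599; 703]; [:: 483; 543; 596; 656];
  [:: 419; 540; 602; 661]; [:: 363; 373; 388; 392]; [:: 363; 704; 707; 710];
  [:: 363; 677; 680; 683]; [:: 373; 547; 559; 562]; [:: 388; 594; 597; 609];
  [:: 392; 467; 475; 495]; [:: 373; 520; 532; 535]; [:: 392; 431; 439; 459];
  [:: 388; 621; 624; 636]; [:: 483; 505; 639; 662]; [:: 414; 529; 606; 665];
  [:: 443; 553; 585; 659]; [:: 415; 503; 586; 643]; [:: 451; 541; 627; 641];
  [:: 463; 550; 591; 642]; [:: 435; 504; 603; 698]; [:: 491; 517; 584; 695];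
  [:: 413; 565; 615; 701]; [:: 455; 513; 600; 692]; [:: 421; 568; 630; 686];
  [:: 487; 538; 577; 689]; [:: 419; 514; 575; 645]; [:: 471; 544; 588; 646];
  [:: 447; 526; 633; 644]; [:: 479; 512; 618; 674]; [:: 427; 556; 576; 671];
  [:: 420; 523; 612; 668]; [:: 357; 551; 554; 557]; [:: 357; 524; 527; 530];
  [:: 379; 428; 444; 460]; [:: 385; 688; 700; 712]; [:: 389; 588; 600; 612];
  [:: 379; 464; 480; 496]; [:: 389; 615; 627; 639]; [:: 385; 661; 673; 685];
  [:: 422; 545; 633; 703]; [:: 456; 542; 586; 670]; [:: 488; 548; 609; 648];
  [:: 423; 498; 584; 649]; [:: 436; 499; 594; 691]; [:: 484; 497; 630; 682];
  [:: 424; 536; 597; 667]; [:: 440; 539; 618; 647]; [:: 468; 533; 585; 706];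
  [:: 410; 521; 603; 679]; [:: 476; 518; 576; 709]; [:: 448; 515; 624; 658];
  [:: 411; 502; 577; 656]; [:: 492; 500; 636; 676]; [:: 432; 501; 591; 694];
  [:: 412; 566; 621; 697]; [:: 472; 560; 606; 657]; [:: 452; 563; 575; 664];
  [:: 364; 378; 380; 396]; [:: 364; 695; 698; 701]; [:: 364; 668; 671; 674];
  [:: 378; 519; 525; 540]; [:: 380; 432; 448; 452]; [:: 396; 622; 628; 634];
  [:: 378; 546; 552; 567]; [:: 396; 595; 601; 607]; [:: 380; 468; 484; 488];
  [:: 460; 511; 604; 689]; [:: 492; 534; 579; 686]; [:: 423; 564; 625; 692];
  [:: 424; 509; 580; 642]; [:: 428; 522; 619; 643]; [:: 476; 558; 610; 641];
  [:: 472; 510; 640; 680]; [:: 422; 528; 589; 683]; [:: 444; 543; 578; 677];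
  [:: 480; 507; 637; 665]; [:: 440; 555; 583; 662]; [:: 412; 531; 613; 659];
  [:: 410; 508; 581; 646]; [:: 496; 561; 598; 644]; [:: 436; 516; 616; 645];
  [:: 456; 506; 592; 710]; [:: 411; 549; 631; 704]; [:: 464; 537; 582; 707];
  [:: 368; 374; 381; 400]; [:: 368; 596; 599; 602]; [:: 368; 623; 626; 629];
  [:: 374; 550; 553; 565]; [:: 381; 436; 440; 456]; [:: 400; 666; 672; 678];
  [:: 374; 523; 526; 538]; [:: 400; 693; 699; 705]; [:: 381; 472; 476; 492];
  [:: 496; 504; 620; 681]; [:: 452; 532; 617; 655]; [:: 424; 556; 614; 711];
  [:: 422; 505; 574; 653]; [:: 480; 535; 572; 696]; [:: 432; 544; 573; 660];
  [:: 448; 503; 611; 690]; [:: 423; 520; 605; 675]; [:: 464; 568; 608; 654];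
  [:: 444; 514; 590; 702]; [:: 484; 562; 587; 651]; [:: 411; 541; 593; 669];
  [:: 412; 512; 570; 652]; [:: 428; 547; 571; 663]; [:: 488; 529; 569; 708];
  [:: 468; 513; 635; 684]; [:: 410; 559; 638; 687]; [:: 460; 517; 632; 650];
  [:: 34; 35; 371; 375]; [:: 114; 115; 362; 366]; [:: 194; 195; 395; 399];
  [:: 274; 275; 385; 389]; [:: 116; 119; 359; 360]; [:: 140; 141; 142; 358];
  [:: 167; 168; 169; 358]; [:: 0; 87; 88; 89]; [:: 0; 117; 121; 355];
  [:: 0; 247; 248; 249]; [:: 0; 300; 301; 302]; [:: 1; 60; 61; 62];
  [:: 1; 118; 120; 355]; [:: 1; 220; 221; 222]; [:: 1; 327; 328; 329];
  [:: 60; 63; 66; 370]; [:: 87; 90; 93; 369]; [:: 2; 37; 41; 354];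
  [:: 2; 167; 170; 173]; [:: 2; 247; 250; 253]; [:: 2; 327; 330; 333];
  [:: 3; 38; 40; 354]; [:: 3; 140; 143; 146]; [:: 3; 220; 223; 226];
  [:: 3; 300; 303; 306]; [:: 276; 279; 380; 381]; [:: 300; 304; 308; 379];
  [:: 327; 331; 335; 379]; [:: 4; 87; 91; 95]; [:: 4; 167; 171; 175];
  [:: 4; 220; 224; 228]; [:: 4; 277; 281; 357]; [:: 5; 60; 64; 68];
  [:: 5; 140; 144; 148]; [:: 5; 247; 251; 255]; [:: 5; 278; 280; 357];
  [:: 196; 199; 391; 392]; [:: 220; 225; 227; 390]; [:: 247; 252; 254; 390];
  [:: 6; 60; 65; 67]; [:: 6; 167; 172; 174]; [:: 6; 197; 201; 356];
  [:: 6; 300; 305; 307]; [:: 7; 87; 92; 94]; [:: 7; 140; 145; 147];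
  [:: 7; 198; 200; 356]; [:: 7; 327; 332; 334]; [:: 8; 131; 162; 190];
  [:: 8; 134; 163; 188]; [:: 8; 137; 161; 189]; [:: 9; 122; 154; 180];
  [:: 9; 125; 152; 181]; [:: 9; 128; 153; 179]; [:: 10; 42; 73; 103];
  [:: 10; 45; 76; 97]; [:: 10; 48; 70; 100]; [:: 11; 291; 321; 352];
  [:: 11; 294; 325; 347]; [:: 11; 297; 320; 348]; [:: 12; 202; 232; 264];
  [:: 12; 205; 237; 257]; [:: 12; 208; 230; 259]; [:: 13; 51; 85; 109];
  [:: 13; 54; 79; 112]; [:: 13; 57; 82; 106]; [:: 14; 211; 246; 268];
  [:: 14; 214; 239; 273]; [:: 14; 217; 241; 266]; [:: 15; 282; 316; 339];
  [:: 15; 285; 311; 343]; [:: 15; 288; 312; 338]; [:: 16; 39; 75; 111];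
  [:: 16; 116; 150; 186]; [:: 16; 199; 236; 272]; [:: 16; 276; 313; 349];
  [:: 17; 49; 86; 93]; [:: 17; 116; 151; 185]; [:: 17; 209; 244; 254];
  [:: 17; 296; 304; 341]; [:: 18; 59; 66; 104]; [:: 18; 116; 149; 187];
  [:: 18; 219; 227; 262]; [:: 18; 286; 323; 331]; [:: 19; 39; 69; 108];
  [:: 19; 126; 165; 168]; [:: 19; 203; 242; 254]; [:: 19; 289; 319; 331];
  [:: 20; 43; 83; 93]; [:: 20; 129; 164; 168]; [:: 20; 216; 227; 258];
  [:: 20; 276; 317; 345]; [:: 21; 56; 66; 98]; [:: 21; 123; 166; 168];
  [:: 21; 199; 229; 270]; [:: 21; 293; 304; 342]; [:: 22; 39; 72; 105];
  [:: 22; 136; 141; 183]; [:: 22; 213; 227; 260]; [:: 22; 299; 304; 337];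
  [:: 23; 46; 80; 93]; [:: 23; 133; 141; 184]; [:: 23; 199; 234; 265];
  [:: 23; 283; 324; 331]; [:: 24; 53; 66; 101]; [:: 24; 139; 141; 182];
  [:: 24; 206; 240; 254]; [:: 24; 276; 309; 353]; [:: 25; 36; 81; 99];
  [:: 25; 119; 160; 178]; [:: 25; 196; 243; 261]; [:: 25; 279; 326; 344];
  [:: 26; 55; 74; 90]; [:: 26; 119; 158; 177]; [:: 26; 215; 233; 252];
  [:: 26; 290; 308; 351]; [:: 27; 47; 63; 110]; [:: 27; 119; 159; 176];
  [:: 27; 207; 225; 269]; [:: 27; 298; 315; 335]; [:: 28; 36; 84; 96];
  [:: 28; 138; 157; 169]; [:: 28; 218; 231; 252]; [:: 28; 292; 314; 335];
  [:: 29; 58; 71; 90]; [:: 29; 132; 156; 169]; [:: 29; 204; 225; 271];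
  [:: 29; 279; 318; 340]; [:: 30; 44; 63; 113]; [:: 30; 135; 155; 169];
  [:: 30; 196; 245; 256]; [:: 30; 287; 308; 346]; [:: 31; 36; 78; 102];
  [:: 31; 130; 142; 193]; [:: 31; 210; 225; 267]; [:: 31; 284; 308; 350];
  [:: 32; 52; 77; 90]; [:: 32; 127; 142; 191]; [:: 32; 196; 238; 263];
  [:: 32; 295; 310; 335]; [:: 33; 50; 63; 107]; [:: 33; 124; 142; 192];
  [:: 33; 212; 235; 252]; [:: 33; 279; 322; 336]; [:: 34; 122; 206; 287];
  [:: 34; 123; 207; 285]; [:: 34; 124; 205; 286]; [:: 35; 131; 216; 295];
  [:: 35; 132; 214; 296]; [:: 35; 133; 215; 294]; [:: 37; 176; 259; 342];
  [:: 37; 179; 262; 336]; [:: 37; 182; 256; 339]; [:: 38; 158; 241; 324];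
  [:: 38; 161; 244; 318]; [:: 38; 164; 238; 321]; [:: 40; 149; 235; 312];
  [:: 40; 152; 229; 315]; [:: 40; 155; 232; 309]; [:: 41; 185; 271; 348];
  [:: 41; 188; 265; 351]; [:: 41; 191; 268; 345]; [:: 42; 115; 204; 293];
  [:: 42; 143; 233; 323]; [:: 42; 173; 263; 353]; [:: 43; 115; 202; 292];
  [:: 43; 153; 243; 303]; [:: 43; 193; 253; 343]; [:: 44; 115; 203; 291];
  [:: 44; 163; 223; 313]; [:: 44; 183; 273; 333]; [:: 45; 127; 219; 275];
  [:: 45; 156; 240; 303]; [:: 45; 177; 270; 333]; [:: 46; 125; 218; 275];
  [:: 46; 160; 223; 316]; [:: 46; 173; 257; 350]; [:: 47; 126; 217; 275];
  [:: 47; 143; 236; 320]; [:: 47; 190; 253; 337]; [:: 48; 139; 195; 290];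
  [:: 48; 166; 223; 310]; [:: 48; 187; 253; 340]; [:: 49; 138; 195; 288];
  [:: 49; 143; 230; 326]; [:: 49; 180; 267; 333]; [:: 50; 137; 195; 289];
  [:: 50; 150; 246; 303]; [:: 50; 173; 260; 347]; [:: 51; 114; 212; 283];
  [:: 51; 146; 245; 317]; [:: 51; 170; 269; 341]; [:: 52; 114; 213; 282];
  [:: 52; 165; 237; 306]; [:: 52; 181; 250; 349]; [:: 53; 114; 211; 284];
  [:: 53; 157; 226; 325]; [:: 53; 189; 261; 330]; [:: 54; 135; 209; 274];
  [:: 54; 159; 234; 306]; [:: 54; 192; 258; 330]; [:: 55; 136; 208; 274];
  [:: 55; 154; 226; 319]; [:: 55; 170; 272; 338]; [:: 56; 134; 210; 274];
  [:: 56; 146; 239; 314]; [:: 56; 178; 250; 352]; [:: 57; 129; 194; 298];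
  [:: 57; 151; 226; 322]; [:: 57; 184; 250; 346]; [:: 58; 128; 194; 299];
  [:: 58; 146; 242; 311]; [:: 58; 186; 264; 330]; [:: 59; 130; 194; 297];
  [:: 59; 162; 231; 306]; [:: 59; 170; 266; 344]; [:: 61; 131; 242; 350];
  [:: 61; 136; 243; 348]; [:: 61; 138; 241; 349]; [:: 62; 122; 234; 340];
  [:: 62; 127; 232; 341]; [:: 62; 129; 233; 339]; [:: 64; 160; 268; 299];
  [:: 64; 161; 272; 292]; [:: 64; 165; 267; 294]; [:: 65; 177; 205; 317];
  [:: 65; 179; 209; 310]; [:: 65; 184; 204; 312]; [:: 67; 186; 218; 321];
  [:: 67; 188; 213; 326]; [:: 67; 193; 214; 319]; [:: 68; 151; 263; 285];
  [:: 68; 152; 258; 290]; [:: 68; 156; 259; 283]; [:: 69; 118; 230; 346];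
  [:: 69; 153; 269; 278]; [:: 69; 192; 201; 316]; [:: 70; 118; 231; 345];
  [:: 70; 144; 261; 296]; [:: 70; 174; 210; 324]; [:: 71; 118; 229; 347];
  [:: 71; 163; 251; 286]; [:: 71; 182; 217; 307]; [:: 72; 125; 245; 328];
  [:: 72; 159; 251; 288]; [:: 72; 174; 202; 322]; [:: 73; 130; 244; 328];
  [:: 73; 157; 265; 278]; [:: 73; 178; 216; 307]; [:: 74; 123; 246; 328];
  [:: 74; 144; 262; 291]; [:: 74; 190; 201; 309]; [:: 75; 135; 221; 343];
  [:: 75; 144; 257; 298]; [:: 75; 180; 212; 307]; [:: 76; 133; 221; 344];
  [:: 76; 164; 251; 284]; [:: 76; 185; 201; 314]; [:: 77; 137; 221; 342];
  [:: 77; 149; 273; 278]; [:: 77; 174; 206; 320]; [:: 78; 120; 240; 338];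
  [:: 78; 166; 264; 280]; [:: 78; 181; 197; 323]; [:: 79; 120; 238; 337];
  [:: 79; 148; 271; 289]; [:: 79; 172; 215; 313]; [:: 80; 120; 239; 336];
  [:: 80; 155; 255; 297]; [:: 80; 189; 207; 305]; [:: 81; 139; 237; 329];
  [:: 81; 154; 255; 293]; [:: 81; 172; 219; 311]; [:: 82; 132; 236; 329];
  [:: 82; 158; 260; 280]; [:: 82; 191; 203; 305]; [:: 83; 134; 235; 329];
  [:: 83; 148; 266; 287]; [:: 83; 176; 197; 325]; [:: 84; 128; 222; 353];
  [:: 84; 148; 270; 282]; [:: 84; 187; 208; 305]; [:: 85; 126; 222; 351];
  [:: 85; 150; 255; 295]; [:: 85; 183; 197; 318]; [:: 86; 124; 222; 352];
  [:: 86; 162; 256; 280]; [:: 86; 172; 211; 315]; [:: 88; 122; 260; 314];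
  [:: 88; 126; 261; 312]; [:: 88; 130; 259; 313]; [:: 89; 131; 270; 322];
  [:: 89; 135; 268; 323]; [:: 89; 139; 269; 321]; [:: 91; 178; 232; 289];
  [:: 91; 179; 236; 284]; [:: 91; 183; 231; 285]; [:: 92; 159; 214; 353];
  [:: 92; 161; 219; 346]; [:: 92; 166; 212; 348]; [:: 94; 150; 210; 339];
  [:: 94; 152; 203; 344]; [:: 94; 157; 205; 337]; [:: 95; 187; 245; 294];
  [:: 95; 188; 240; 298]; [:: 95; 192; 241; 293]; [:: 96; 121; 258; 320];
  [:: 96; 163; 198; 341]; [:: 96; 184; 246; 281]; [:: 97; 121; 256; 319];
  [:: 97; 145; 207; 349]; [:: 97; 175; 235; 299]; [:: 98; 121; 257; 318];
  [:: 98; 153; 215; 332]; [:: 98; 191; 228; 288]; [:: 99; 129; 273; 302];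
  [:: 99; 145; 209; 347]; [:: 99; 190; 228; 283]; [:: 100; 124; 272; 302];
  [:: 100; 155; 213; 332]; [:: 100; 176; 242; 281]; [:: 101; 125; 271; 302];
  [:: 101; 158; 198; 343]; [:: 101; 175; 230; 295]; [:: 102; 137; 249; 317];
  [:: 102; 151; 217; 332]; [:: 102; 175; 234; 291]; [:: 103; 136; 249; 315];
  [:: 103; 165; 198; 336]; [:: 103; 186; 228; 287]; [:: 104; 132; 249; 316];
  [:: 104; 145; 202; 351]; [:: 104; 180; 238; 281]; [:: 105; 117; 266; 310];
  [:: 105; 156; 200; 352]; [:: 105; 189; 233; 277]; [:: 106; 117; 267; 309];
  [:: 106; 147; 218; 342]; [:: 106; 171; 243; 286]; [:: 107; 117; 265; 311];
  [:: 107; 164; 208; 334]; [:: 107; 181; 224; 296]; [:: 108; 134; 263; 301];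
  [:: 108; 147; 211; 340]; [:: 108; 177; 224; 297]; [:: 109; 138; 262; 301];
  [:: 109; 160; 206; 334]; [:: 109; 193; 229; 277]; [:: 110; 133; 264; 301];
  [:: 110; 154; 200; 345]; [:: 110; 171; 244; 282]; [:: 111; 127; 248; 325];
  [:: 111; 162; 204; 334]; [:: 111; 171; 239; 290]; [:: 112; 123; 248; 326];
  [:: 112; 149; 200; 350]; [:: 112; 182; 224; 292]; [:: 113; 128; 248; 324];
  [:: 113; 147; 216; 338]; [:: 113; 185; 237; 277]
]%num.

(** * Properties of the table checked by computation *)

Definition row_map : PositiveMap.t (seq N) :=
  (foldl (fun im r => (N.succ im.1, PositiveMap.add (N.succ_pos im.1) r im.2))
     (0%num, PositiveMap.empty _) rows).2.

(** The default [[::]] is never met at a label, since [nbs_regular] finds four entries there. *)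
Definition nbs (x : N) : seq N :=
  odflt [::] (PositiveMap.find (N.succ_pos x) row_map).

Definition labels : seq N := [seq bin_of_nat i | i <- iota 0 713].

(** This allows every entry of a row to be read back as a vertex in ['I_713]. *)
Lemma nbs_labels : all (fun x => all [in labels] (nbs x)) labels.
Proof. by vm_compute. Qed.

Lemma nbs_sym : all (fun x => all (fun y => x \in nbs y) (nbs x)) labels.
Proof. by vm_compute. Qed.

Lemma nbs_irr : all (fun x => x \notin nbs x) labels.
Proof. by vm_compute. Qed.

Lemma nbs_regular : all (fun x => uniq (nbs x) && (size (nbs x) == 4)) labels.
Proof. by vm_compute. Qed.

(** Length 5 is what is required to exclude cycles of length up to 10, cut into halves of at most
    five edges. *)
Lemma nbs_walks :
  all (fun x => distinct (PositiveMap.empty _) (walk_ends nbs 5 x x)) labels.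
Proof. by vm_compute. Qed.

(** * The graph on 713 vertices *)

(** The graph needs a finite type, while the checks run on binary numbers; [label] carries the
    results over. *)
Definition label (i : 'I_713) : N := bin_of_nat i.

Lemma label_inj : injective label.
Proof. by move=> i j /(can_inj bin_of_natK) /val_inj. Qed.

Lemma labelsP x : reflect (exists i, x = label i) (x \in labels).
Proof.
apply: (iffP mapP) => [[n] | [i ->]].
  by rewrite mem_iota /= => n_lt ->; exists (Ordinal n_lt).
by exists (val i); rewrite // mem_iota /= ltn_ord.
Qed.

Lemma label_in i : label i \in labels.
Proof. by apply/labelsP; exists i. Qed.

Definition adj713 : rel 'I_713 := fun i j => label j \in nbs (label i).

Lemma adj713_sym : symmetric adj713.
Proof.
suff imp i j : adj713 i j -> adj713 j i by move=> i j; apply/idP/idP; apply: imp.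
by move=> ij; have /allP/(_ _ ij) := allP nbs_sym _ (label_in i).
Qed.

Lemma adj713_irr : irreflexive adj713.
Proof. by move=> i; apply/negbTE/(allP nbs_irr)/label_in. Qed.

Definition graph713 := SGraph adj713_sym adj713_irr.

Lemma graph713_regular : regular 4 graph713.
Proof.
move=> i; have /andP[u /eqP <-] := allP nbs_regular _ (label_in i).
(* The degree is compared with the length of the row: the labels of the neighbours and the row are
   two lists without repetition that have the same elements. *)
rewrite cardE -(size_map label); apply/perm_size/uniq_perm => //.
  by rewrite (map_inj_uniq label_inj) enum_uniq.
move=> x; apply/mapP/idP => [[j] | xi]; first by rewrite mem_enum inE => ij ->.
have /allP/(_ _ xi)/labelsP[j def_x] := allP nbs_labels _ (label_in i).
by exists j; rewrite // mem_enum inE /= /adj713 -def_x.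
Qed.

Lemma map_label_ucycle c :
  ucycle (nbrel nbs) [seq label i | i <- c] = ucycle (@adj graph713) c.
Proof. by rewrite /ucycle cycle_map (map_inj_uniq label_inj). Qed.

Lemma graph713_girth : has_girth graph713 11.
Proof.
split.
  (* The incidence graph is bipartite, so a cycle of odd length must use a new edge. Here it is the
     edge between 370 and 369: it replaces two edges through a deleted vertex, which turns a
     12-cycle of the hexagon into an 11-cycle. *)
  pose s := [:: 361; 87; 370; 369; 63; 493; 107; 692; 117; 362; 0]%num.
  have s_labels : all [in labels] s by vm_compute.
  (* Lifting [s] to vertices through [labelsP] leaves the adjacency check to be computed on [N]. *)
  have [c def_s] : exists c, s = [seq label i | i <- c].
    elim: s s_labels => [|x s IHs] /= => [_ | /andP[/labelsP[i ->] /IHs[c ->]]].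
      by exists [::].
    by exists (i :: c).
  have size_c : size c = 11 by rewrite -(size_map label) -def_s.
  exists c; last exact: size_c.
  split; last by rewrite size_c.
  by rewrite -map_label_ucycle -def_s; vm_compute.
move=> c [c_cycle c_ge3]; rewrite leqNgt; apply/negP=> c_lt.
(* A cycle shorter than 11 has length at most 10, which is [5.*2]. *)
apply: (@short_cycleF _ nbs 5 [seq label i | i <- c]).
- by move=> _ _ /mapP[i _ ->] /mapP[j _ ->]; apply: adj713_sym.
- move=> _ /mapP[i _ ->].
  by have [] := distinct_uniq (allP nbs_walks _ (label_in i)).
- by rewrite map_label_ucycle.
- by rewrite size_map c_ge3.
Qed.

(** * Existence of the smallest order *)

(** The orders of such graphs form a nonempty set of natural numbers, which has a least element.
    Membership in this set is not decided by a procedure here, hence the appeal to excluded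
    middle. *)
Lemma min_order_exists k g (G : sgraph) :
  kg_graph k g G -> exists2 n, min_order k g n & n <= #|G|.
Proof.
move=> Gkg; pose P n := exists2 H : sgraph, kg_graph k g H & #|H| = n.
have [||n [[Pn n_min] _]] := @dec_inh_nat_subset_has_unique_least_element P.
- by move=> n; apply: classic.
- by exists #|G|, G.
exists n; last by apply/leP/n_min; exists G.
by split=> // H Hkg; apply/leP/n_min; exists H.
Qed.

Theorem mainTheorem5 :
  (exists2 n : nat, min_order 4 11 n & n <= 713)
  /\ (exists2 G : sgraph, kg_graph 4 11 G & #|G| <= 713).
Proof.
have Gkg : kg_graph 4 11 graph713.
  by split; [apply: graph713_regular | apply: graph713_girth].
have card_G : #|graph713| = 713 by rewrite card_ord.
split; last by exists graph713; rewrite ?card_G.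
by have := min_order_exists Gkg; rewrite card_G.
Qed.
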